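(* Let $n\ge2$ and let $X_{\cdot,B}$ be a simple (undirected, loopless) quantum graph on $M_n$, i.e. $B\in M_n$ is a real symmetric projector with $B\mathbf 1=0$. Then $X_{\cdot,B}$ has $n$ connected components.
   Context: $M_n=M_n(\mathbb C)$; ''projector'' means orthogonal projector; $\mathbf 1\in\mathbb C^n$ is the all-ones vector. $X_{\cdot,B}$ is the quantum graph on $M_n$ with adjacency operator the Schur multiplier $x\mapsto (B_{ij}x_{ij})_{i,j}$. A quantum graph with adjacency operator $G\colon M_n\to M_n$ has (at least) $k$ connected components if there exist non-zero projectors $P_1,\dots,P_k$ on $\mathbb C^n$ with $\sum_sP_s=I$ such that $L_{P_s}\,G\,L_{P_t}=0$ for all $s\ne t$, where $L_P(x)=Px$ is left multiplication; the number of connected components is the largest such $k$. *)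

(* Defs.v *)
From HB Require Import structures.
From mathcomp Require Import all_boot all_order all_algebra.
From mathcomp Require Import reals.
From mathcomp Require Export complex.

Set Implicit Arguments.
Unset Strict Implicit.
Unset Printing Implicit Defensive.

Import Order.TTheory GRing.Theory Num.Theory.
Local Open Scope ring_scope.
Local Open Scope sesquilinear_scope.

Section QuantumGraph.
Variables (C : numClosedFieldType) (n : nat).
Implicit Types (B P : 'M[C]_n) (G : {linear 'M[C]_n -> 'M[C]_n}).

(* orthogonal projector *)
Definition projector P : Prop := P *m P = P /\ P ^t* = P.

Definition schur_mul B (x : 'M[C]_n) : 'M[C]_n :=
  \matrix_(i, j) (B i j * x i j).

Fact schur_mul_is_linear B : linear (schur_mul B).
Proof.
by move=> a x y; apply/matrixP=> i j; rewrite !mxE mulrDr mulrCA.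
Qed.

HB.instance Definition _ B :=
  GRing.isLinear.Build C 'M[C]_n 'M[C]_n *:%R (schur_mul B)
    (schur_mul_is_linear B).

(* The quantum graph on M_n with adjacency operator schur_mul B is simple
   (undirected and loopless). *)
Definition simple_schur_graph B : Prop :=
  [/\ B \is a realmx, B^T = B, projector B & B *m const_mx 1 = 0 :> 'cV[C]_n].

(* A quantum graph on M_n is represented by its adjacency operator G;
   mulmx P is the left multiplication L_P. *)
Definition has_components G (k : nat) : Prop :=
  exists P : 'I_k -> 'M[C]_n,
    [/\ forall s, projector (P s) /\ P s <> 0,
        \sum_s P s = 1%:M &
        forall s t, s != t -> mulmx (P s) \o G \o mulmx (P t) =1 (fun=> 0)].

Definition number_of_components G (m : nat) : Prop :=
  has_components G m /\ forall k, has_components G k -> (k <= m)%N.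

End QuantumGraph.

(* Main.v *)
(** The coordinate projectors e_s e_s^* are diagonal, hence compatible with
    every Schur multiplier, so they always give n components.  Conversely the
    trace of an idempotent is its rank, so k non-zero projectors with sum I
    satisfy n = tr I = sum of the ranks >= k. *)
Require Import Defs.
From mathcomp Require Import all_boot all_order all_algebra.
From mathcomp Require Import reals.

Import GRing.Theory Num.Theory.
Local Open Scope ring_scope.

(** In the full-rank factorisation [P = col_base P *m row_base P], idempotence forces the reversed
    product to be the identity of size [\rank P], and the trace is cyclic. *)
Lemma mxtrace_idempotent (F : fieldType) (n : nat) (P : 'M[F]_n) :
  P *m P = P -> \tr P = (\rank P)%:R.
Proof.
move=> idP; suff E : row_base P *m col_base P = 1%:M.
  by rewrite -{1}(mulmx_base P) mxtrace_mulC E mxtrace1.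
(* Cancelling [row_base P] on the right and [col_base P] on the left reduces the goal to
   [P *m P = P]. *)
apply: (row_free_inj (row_base_free P)).
apply: (row_full_inj (col_base_full P)).
by rewrite mul1mx -[X in col_base P *m X]mulmxA !mulmx_base mulmxA mulmx_base.
Qed.

Lemma idempotent_decomposition_leq (F : numFieldType) (n k : nat)
    (P : 'I_k -> 'M[F]_n) :
  (forall s, P s *m P s = P s) -> (forall s, P s != 0) ->
  \sum_s P s = 1%:M -> (k <= n)%N.
Proof.
move=> idP P0 sumP.
(* Traces live in [F]; characteristic zero then brings the equality of ranks back to [nat]. *)
have /eqP : (\sum_s \rank (P s))%N%:R = n%:R :> F.
  rewrite natr_sum -(mxtrace1 F n) -sumP raddf_sum.
  by apply: eq_bigr => s _; rewrite -mxtrace_idempotent.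
rewrite eqr_nat => /eqP <-; rewrite -{1}(card_ord k) -sum1_card.
by apply: leq_sum => s _; rewrite lt0n mxrank_eq0.
Qed.

Lemma projector_delta_mx (C : numClosedFieldType) (n : nat) (s : 'I_n) :
  projector (delta_mx s s : 'M[C]_n).
Proof.
split; first by rewrite mul_delta_mx.
by apply/matrixP => i j; rewrite !mxE conjC_nat andbC.
Qed.

Lemma delta_mx_neq0 (R : nzRingType) (m n : nat) (i : 'I_m) (j : 'I_n) :
  delta_mx i j != 0 :> 'M[R]_(m, n).
Proof.
by apply/eqP => /matrixP/(_ i j)/eqP; rewrite !mxE !eqxx oner_eq0.
Qed.

Lemma mul_delta_mxE (R : nzRingType) (m n : nat) (s : 'I_m)
    (x : 'M[R]_(m, n)) i j :
  (delta_mx s s *m x) i j = (i == s)%:R * x i j.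
Proof.
rewrite mxE (bigD1 s) //= big1 => [|l ls].
  by rewrite mxE eqxx andbT addr0; case: eqP => [->|]; rewrite ?mul0r.
by rewrite mxE (negPf ls) andbF mul0r.
Qed.

Lemma schur_mul_has_components (C : numClosedFieldType) (n : nat)
    (B : 'M[C]_n) : has_components (schur_mul B) n.
Proof.
exists (fun s => delta_mx s s); split.
- by move=> s; split; [exact: projector_delta_mx | exact/eqP/delta_mx_neq0].
- by rewrite mx1_sum_delta.
- move=> s t st x; apply/matrixP => i j.
  rewrite /= mul_delta_mxE mxE mul_delta_mxE mxE.
  (* A Schur multiplier keeps every entry in its row, so entry [(i, j)] carries both factors
     [i == s] and [i == t], which exclude each other. *)
  by case: eqP => [->|]; rewrite ?mul0r // (negPf st) mul0r mulr0 mulr0.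
Qed.

Theorem corollary4p9 (R : realType) (n : nat) (hn : (2 <= n)%N)
    (B : 'M[R[i]]_n) (hB : simple_schur_graph B) :
  number_of_components (schur_mul B) n.
Proof.
split=> [|k [P [projP sumP _]]]; first exact: schur_mul_has_components.
apply: (idempotent_decomposition_leq _ _ _ P _ _ sumP) => s.
  by case: (projP s) => -[].
by apply/eqP; case: (projP s).
Qed.
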